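(* Let $b = \log 2 - \int_0^\infty \log\left(1 - 2^{-e^{y}}\right) dy$. For $p \in (0,1)$, let $K = K^{(p)}$ be the size of the first block in a $\mathrm{Geo}(p)$-biased permutation of the positive integers. Then $K$ is stochastically dominated by a $\mathrm{Geo}(p e^{-b/p})$ random variable. In particular, $\mathbf{E} K \leq (1/p) e^{b/p}$, and for all $\epsilon > 0$, $$\mathbf{P}\left[K > e^{(b+\epsilon)/p}\right] \to 0 \quad \text{as } p \to 0.$$
   Context: For $r\in(0,1)$, $\mathrm{Geo}(r)$ denotes the geometric distribution on $\{1,2,\dots\}$ with mass $r(1-r)^{j-1}$ at $j$. Let $X_1, X_2, \dots$ be i.i.d. $\mathrm{Geo}(p)$ random variables. The $\mathrm{Geo}(p)$-biased permutation is the map $i \mapsto \Pi_i$, where $(\Pi_1, \Pi_2, \dots)$ is the sequence of distinct values of $(X_1, X_2, \dots)$ in order of appearance (almost surely every positive integer appears). Write $[k] = \{1,\dots,k\}$. The first block is the smallest interval $[K]$ with $\Pi([K]) = [K]$, and the block size is $K = \inf\{k \ge 1 : \Pi([k]) = [k]\}$, with $\inf \emptyset = \infty$. A random variable $Y$ is stochastically dominated by $Z$ if $\mathbf{P}[Y > x] \le \mathbf{P}[Z > x]$ for all real $x$. Numerically $b \approx 1.1524$. *)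

(* Defs.v *)
From HB Require Import structures.
From mathcomp Require Import all_boot all_order all_algebra.
From mathcomp Require Import all_classical all_reals all_analysis.

Set Implicit Arguments.
Unset Strict Implicit.
Unset Printing Implicit Defensive.

Import Order.TTheory GRing.Theory Num.Theory.
Import numFieldNormedType.Exports.

Local Open Scope classical_set_scope.
Local Open Scope ring_scope.

Definition geometric_pmf {R : realType} (r : R) (k : nat) : R :=
  if k is j.+1 then r * (1 - r) ^+ j else 0.

(* Geo(r) as a measure on nat, carried by {1, 2, ...}.  The Dirac mass at 1 is
   a default value that makes this a probability for every r. *)
Definition geometric_prob {R : realType} (r : R) : set nat -> \bar R :=
  fun U => if 0 < r < 1 then \esum_(k in U) (geometric_pmf r k)%:E
           else \d_1%N U.

Section geometric_prob_instance.
Context {R : realType} (r : R).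
Local Open Scope ereal_scope.

Let pmf_ge0 (r01 : (0 < r < 1)%R) k : 0 <= (geometric_pmf r k)%:E.
Proof.
case/andP: r01 => r0 r1; case: k => [|k]; rewrite lee_fin //=.
by rewrite mulr_ge0 ?exprn_ge0 ?subr_ge0 // ltW.
Qed.

Let geo0 : geometric_prob r set0 = 0.
Proof.
by rewrite /geometric_prob measure0; case: ifPn => //; rewrite esum_set0.
Qed.

Let geo_ge0 U : 0 <= geometric_prob r U.
Proof.
rewrite /geometric_prob; case: ifPn => // r01.
by apply: esum_ge0 => n _; exact: pmf_ge0.
Qed.

Let geo_sigma_additive : semi_sigma_additive (geometric_prob r).
Proof.
move=> F mF tF mUF; rewrite /geometric_prob; case: ifPn => r01; last first.
  exact: measure_semi_sigma_additive.
apply: cvg_toP.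
  apply: ereal_nondecreasing_is_cvgn => a b ab.
  apply: lee_sum_nneg_natr => // n _ _.
  by apply: esum_ge0 => /= k _; exact: pmf_ge0.
by rewrite nneseries_sum_bigcup// => i; exact: pmf_ge0.
Qed.

HB.instance Definition _ := isMeasure.Build _ _ _ (geometric_prob r)
  geo0 geo_ge0 geo_sigma_additive.

Let geo_setT : geometric_prob r [set: nat] = 1.
Proof.
rewrite /geometric_prob; case: ifPn => [r01|_]; last by rewrite probability_setT.
rewrite -nneseries_esumT; last by move=> k; exact: pmf_ge0.
have [r0 r1] := andP r01.
apply/cvg_lim => //; rewrite -(cvg_shiftS _) /=.
rewrite (_ : (fun n => _) = EFin \o series (geometric r (1 - r))); last first.
  apply/funext => n /=; rewrite big_nat_recl //= add0e sumEFin.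
  by rewrite /series /=.
apply/cvg_EFin; first by near=> n.
have r1_norm : (`|1 - r| < 1)%R by rewrite ger0_norm ?subr_ge0 ?ltW// gtrBl.
have := cvg_geometric_series (a := r) r1_norm.
by rewrite subKr mulfV ?gt_eqF.
Unshelve. all: by end_near. Qed.

HB.instance Definition _ :=
  @Measure_isProbability.Build _ _ R (geometric_prob r) geo_setT.

End geometric_prob_instance.

Definition has_law_geometric d (T : measurableType d) (R : realType)
    (P : probability T R) (Z : {RV P >-> nat}) (r : R) : Prop :=
  forall U : set nat, distribution P Z U = geometric_prob r U.

Definition mutually_independent d d' (T : measurableType d)
    (T' : measurableType d') (R : realType) (P : probability T R)
    (X : nat -> {RV P >-> T'}) : Prop :=
  forall (s : seq nat) (A : nat -> set T'), uniq s ->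
    (forall i, measurable (A i)) ->
    P (\bigcap_(i in [set` s]) (X i @^-1` A i)) =
    (\prod_(i <- s) P (X i @^-1` A i))%E.

Definition iid_geometric d (T : measurableType d) (R : realType)
    (P : probability T R) (X : nat -> {RV P >-> nat}) (p : R) : Prop :=
  mutually_independent X /\ (forall n, has_law_geometric (X n) p).

Definition stochastically_dominated d d' (T : measurableType d)
    (T' : measurableType d') (R : realType)
    (P : probability T R) (Y : T -> \bar R)
    (Q : probability T' R) (Z : T' -> \bar R) : Prop :=
  forall x : R, (P [set w | x%:E < Y w] <= Q [set w | x%:E < Z w])%E.

(* x n stands for X_{n+1}; values_in_order x k is the k-th distinct value
   (k >= 1) of x in order of appearance: the value x n at the time n at which
   a new value occurs and the number of distinct values reaches k.  It is 0,
   hence outside {1, 2, ...}, if x takes fewer than k distinct values. *)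
Definition values_in_order (x : nat -> nat) (k : nat) : nat :=
  xget 0%N [set x n | n in [set n |
    x n \notin mkseq x n /\ size (undup (mkseq x n.+1)) = k]].

Definition one_to (k : nat) : set nat := [set i | (1 <= i <= k)%N].

(* The infimum of the empty set is +oo. *)
Definition first_block_size (R : realType) (x : nat -> nat) : \bar R :=
  ereal_inf [set k%:R%:E | k in
    [set k | (1 <= k)%N /\ values_in_order x @` one_to k = one_to k]].

Definition b_const (R : realType) : R :=
  ln 2 - \int[@lebesgue_measure R]_(y in `[0, +oo[) ln (1 - 2 `^ (- expR y)).

(* Main.v *)
Require Import Defs.
From HB Require Import structures.
From mathcomp Require Import all_boot all_order all_algebra.
From mathcomp Require Import all_classical all_reals all_analysis.
From mathcomp Require Import measurable_realfun ring lra.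
Set Implicit Arguments.
Unset Strict Implicit.
Unset Printing Implicit Defensive.
Import Order.TTheory GRing.Theory Num.Theory.
Import numFieldNormedType.Exports.
Local Open Scope classical_set_scope.
Local Open Scope ring_scope.

(** Follow the running maximum [M] of the values drawn so far.  A block is
    completed exactly when the set of values already seen is [{1, ..., M}]; call
    this a success of the maximum [M], and say that [M] fails if a value above
    [M] is drawn before that.  Two facts drive the proof, with
    [r = exp (- b / p)].

    - Whatever was seen when [M] became the maximum, [M] succeeds with
      probability at least [r] ([race_ge_success]).
    - The geometric law has no memory: the overshoot of a new maximum over the
      previous one is again [Geo(p)], independent of the past.

    So the size of the first block is at most a sum of [N] independent [Geo(p)]
    variables, where [N] is stochastically at most [Geo(r)].  A sum of [Geo(r)]
    many [Geo(p)] variables has law [Geo(p * r)], which is the claimed bound.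
    The bound on the expectation is the sum of the tails, and the last claim
    follows from [(1 - q) ^ m <= exp (- q * m) <= 1 / (q * x)], for
    [q = p * r] and [m] the integer part of [x].

    For the first fact, replace the draws by independent exponential clocks: one
    of rate [w a] for each missing value [a] below [M], and one of rate
    [w0 = (1 - p) ^ M] for all the values above [M].  The maximum succeeds when
    all the former ring before the latter ([race]).  This happens in particular
    if, at a fixed time [s], all of the former have rung and the latter has not,
    whence [race_ge].  At [s = ln 2 / (p * w0)] the clock of the larger values
    is silent with probability [2 ^ (- 1 / p)], and the clock of the value
    [M + 1 - j] has rung with probability at least [1 - 2 ^ (- exp (p * j))].
    Minus the logarithm of the product of the latter over [j] is, up to the
    factor [1 / p], a lower Riemann sum with step [p] for the integral in the
    definition of [b] ([b_const_ge_sum]).  The number [ln 2] is the minimiser of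
    [s - \int_0^oo ln (1 - exp (- s * exp y)) dy], so that this choice of [s]
    has the best exponential order.

    The sum of [N] geometric variables is not constructed.  Instead, fix [n] and
    assign to every set [S] of values seen so far a [potential] that bounds the
    conditional probability of a first block larger than [n].  It is a
    supersolution of the one-step equation ([potential_super]), so iterating the
    equation [t] times bounds the tail, up to the probability that [t] draws all
    are at most [n], which vanishes as [t] grows ([tail_potential],
    [tail_event_le]). *)

(** * Calculus *)

Lemma is_derive_prod {R : realType} {I : eqType} (f : I -> R -> R)
    (df : I -> R) (x : R) (r : seq I) :
  uniq r -> (forall i, is_derive x (1 : R) (f i) (df i)) ->
  is_derive x (1 : R) (fun y => \prod_(i <- r) f i y)
    (\sum_(i <- r) df i * \prod_(j <- r | j != i) f j x).
Proof.
move=> + fdf; elim: r => [|a r IHr] /=.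
  move=> _; rewrite big_nil; under eq_fun do rewrite big_nil.
  exact: is_derive_cst.
move=> /andP[ar ur]; under eq_fun do rewrite big_cons.
have := is_deriveM (fdf a) (IHr ur) => /is_derive_eq; apply.
rewrite !big_cons eqxx /= addrC; congr (_ + _).
  rewrite /GRing.scale /= mulrC; congr (_ * _).
  rewrite [RHS]big_seq_cond [LHS]big_seq; apply: eq_bigl => j.
  by case: (boolP (j \in r)) => //= jr; rewrite (memPn ar).
rewrite /GRing.scale /= mulr_sumr [LHS]big_seq [RHS]big_seq; apply: eq_bigr => i ir.
by rewrite big_cons (memPnC ar) // mulrCA.
Qed.

Lemma le_is_derive_ge0 {R : realType} (f df : R -> R) :
  (forall x, is_derive x (1 : R) f (df x)) ->
  (forall x, 0 < x -> 0 <= df x) -> forall x, 0 <= x -> f 0 <= f x.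
Proof.
move=> fdf df0 x x0; apply: (@ger0_derive1_ndecry _ f 0) => //.
  move=> y; rewrite in_itv/= andbT => y0.
  by have fy := fdf y; rewrite derive1E derive_val; exact: df0.
apply: derivable_within_continuous => y _.
have fy := fdf y; exact: ex_derive.
Qed.

(** * A race between exponential clocks *)

Section race.
Context {R : realType} {I : finType} (w : I -> R) (w0 : R).
Context (w_gt0 : forall i, 0 < w i) (w0_gt0 : 0 < w0).

(** [k] is fuel for the recursion, meant to be the cardinal of [A]. *)
Fixpoint race_upto (k : nat) (A : {set I}) : R :=
  if k is k'.+1 then
    (\sum_(a in A) w a * race_upto k' (A :\ a)) / (w0 + \sum_(a in A) w a)
  else 1.

(** The probability that independent exponential clocks of rates [w a], for [a]
    in [A], all ring before an independent clock of rate [w0].  The recursion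
    conditions on the first clock to ring; it also describes the sequence of
    draws itself, as the first relevant draw falls on [a] with probability
    proportional to [w a]. *)
Definition race (A : {set I}) : R := race_upto #|A| A.

Lemma race0 : race finset.set0 = 1.
Proof. by rewrite /race cards0. Qed.

Lemma total_rate_gt0 (A : {set I}) : 0 < w0 + \sum_(a in A) w a.
Proof. by rewrite ltr_wpDr // sumr_ge0 // => a _; rewrite ltW. Qed.

Lemma race_rec (A : {set I}) : A != finset.set0 ->
  (w0 + \sum_(a in A) w a) * race A = \sum_(a in A) w a * race (A :\ a).
Proof.
rewrite -card_gt0 => A0.
rewrite /race -{1}(prednK A0) /= mulrC divfK; last first.
  by rewrite gt_eqF ?total_rate_gt0.
by apply: eq_bigr => a aA; rewrite (cardsD1 a A) aA.
Qed.

Lemma race_bounds (A : {set I}) : 0 <= race A <= 1.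
Proof.
rewrite /race; move: #|A| => k; elim: k A => [|k IHk] A /=.
  by rewrite ler01 lexx.
have [w_ge0 W0] := (fun a => ltW (w_gt0 a), total_rate_gt0 A).
apply/andP; split.
  apply: divr_ge0; last exact: ltW.
  apply: sumr_ge0 => a _; apply: mulr_ge0 => //.
  by have /andP[] := IHk (A :\ a).
rewrite ler_pdivrMr ?total_rate_gt0 // mul1r.
apply: ler_wpDl; first exact: ltW.
apply: ler_sum => a _; apply: ler_piMr => //.
by have /andP[] := IHk (A :\ a).
Qed.

(** Both sides, as functions of [s], are compared through their derivatives: by
    induction on the cardinal of [A] the derivative of the product is at most
    the derivative of the right-hand side, because [race_rec] says exactly that
    the right-hand sides for [A :\ a] add up to it. *)
Lemma prod_expRB1_le_race (A : {set I}) (s : R) : 0 <= s ->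
  \prod_(a in A) (expR (w a * s) - 1) <=
  race A * expR ((w0 + \sum_(a in A) w a) * s).
Proof.
move: {2}#|A| (erefl #|A|) => k; elim: k A s => [|k IHk] A s Ak s0.
  move/cards0_eq : Ak => ->.
  rewrite !big_set0 race0 mul1r addr0 -expR0 ler_expR mulr_ge0 ?expR0 //.
  exact: ltW.
have A0 : A != finset.set0 by rewrite -card_gt0 Ak.
have -> : \prod_(a in A) (expR (w a * s) - 1) =
    \prod_(a <- enum A) (expR (w a * s) - 1) by rewrite big_enum.
pose W := w0 + \sum_(a in A) w a.
pose H (s : R) :=
  race A * expR (W * s) - \prod_(a <- enum A) (expR (w a * s) - 1).
pose dH (s : R) := race A * (W * expR (W * s)) -
   \sum_(a <- enum A) (w a * expR (w a * s)) *
      \prod_(b <- enum A | b != a) (expR (w b * s) - 1).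
have dexp (c x : R) :
    is_derive x (1 : R) (fun y => expR (c * y)) (c * expR (c * x)).
  have -> : (fun y => expR (c * y)) = expR \o (c \*: id) by [].
  by apply: is_derive_eq; rewrite /GRing.scale /= mulr1 mulrC.
have HdH x : is_derive x (1 : R) H (dH x).
  apply: (@is_deriveB R R R (fun y => race A * expR (W * y))
    (fun y => \prod_(a <- enum A) (expR (w a * y) - 1))).
  apply: (is_derive_prod (f := fun a y => expR (w a * y) - 1)).
    exact: enum_uniq.
  move=> a; have := is_deriveB (dexp (w a) x) (is_derive_cst (1 : R) x (1 : R)).
  by rewrite subr0.
suff : 0 <= H s by rewrite subr_ge0.
apply: (@le_trans _ _ (H 0)).
  rewrite /H mulr0 expR0 mulr1 subr_ge0.
  have [a aA] := set0Pn _ A0.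
  rewrite big_enum /= (bigD1 a) //= mulr0 expR0 subrr mul0r.
  by have /andP[] := race_bounds A.
apply: (le_is_derive_ge0 HdH) => // x x0.
rewrite /dH subr_ge0 mulrCA mulrA race_rec // big_enum /= mulr_suml.
apply: ler_sum => a aA; rewrite -!mulrA ler_wpM2l //; first exact: ltW.
have -> : \prod_(b <- enum A | b != a) (expR (w b * x) - 1) =
    \prod_(b in A :\ a) (expR (w b * x) - 1).
  by rewrite big_enum_cond /=; apply: eq_bigl => b; rewrite !inE andbC.
apply: le_trans (ler_wpM2l (expR_ge0 _) (IHk (A :\ a) x _ (ltW x0))) _.
  by move: Ak; rewrite (cardsD1 a A) aA => -[].
rewrite mulrCA -expRD -mulrDl.
by rewrite /W (big_setD1 a aA) /= addrCA.
Qed.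

(** The left-hand side is the probability that at time [s] all the clocks of
    [A] have rung and the one of rate [w0] has not. *)
Lemma race_ge (A : {set I}) (s : R) : 0 <= s ->
  expR (- (w0 * s)) * \prod_(a in A) (1 - expR (- (w a * s))) <= race A.
Proof.
move=> s0; rewrite -(ler_pM2r (expR_gt0 ((w0 + \sum_(a in A) w a) * s))).
apply: le_trans (prod_expRB1_le_race A s0).
rewrite mulrDl expRD mulrACA -expRD addNr.
rewrite expR0 mul1r mulr_suml expR_sum -big_split /=.
apply: ler_prod => a _; rewrite mulrBl mul1r -expRD addNr expR0 lexx andbT.
by rewrite subr_ge0 -expR0 ler_expR mulr_ge0 // ltW.
Qed.
End race.

(** * The constant b as an upper bound of Riemann sums *)

Section integrals.
Context {R : realType}.
Local Notation mu := (@lebesgue_measure R).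

Lemma lower_sum_le_integral (f : R -> R) (h : R) (n : nat) : 0 < h ->
  {homo f : x y /~ y <= x} -> (forall x, 0 <= x -> 0 <= f x) ->
  ((\sum_(j < n) h * f (h * j.+1%:R))%:E <=
     \int[mu]_(x in `[0%R, (h * n%:R)%R[) (f x)%:E)%E.
Proof.
move=> h0 f_noninc f_ge0.
have mf (D : set R) : measurable_fun D (EFin \o f).
  apply/measurable_EFinP; apply: measurable_funTS.
  exact: (@nonincreasing_measurable R setT f measurableT f_noninc).
elim: n => [|n IHn].
  rewrite big_ord0; apply: integral_ge0 => x /=; rewrite in_itv/= => /andP[x0 _].
  by rewrite lee_fin f_ge0.
have hn : h * n%:R <= h * n.+1%:R by rewrite ler_pM2l // ler_nat.
have hn0 : 0 <= h * n%:R by rewrite mulr_ge0 // ltW.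
have U : `[0%R, (h * n.+1%:R)[%classic =
    `[0%R, (h * n%:R)[%classic `|` `[(h * n%:R), (h * n.+1%:R)[%classic.
  by apply: itv_bndbnd_setU; rewrite bnd_simp.
rewrite U ge0_integral_setU //; first last.
- apply/eqP/seteqP; split => x //=.
  by rewrite !in_itv/= => -[/andP[_ /lt_geF ->]].
- by rewrite -U => x /=; rewrite in_itv/= lee_fin => /andP[/f_ge0].
- exact: mf.
rewrite big_ord_recr /= EFinD; apply: leeD => //.
have -> : (h * f (h * n.+1%:R))%:E =
   (\int[mu]_(x in `[(h * n%:R)%R, (h * n.+1%:R)%R[) (f (h * n.+1%:R))%:E)%E.
  rewrite integral_cst //= lebesgue_measure_itv /= lte_fin ltr_pM2l // ltr_nat.
  by rewrite ltnSn -EFinB -mulrBr -natrB // subSnn mulr1 -EFinM mulrC.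
apply: ge0_le_integral => //.
- by move=> x _; rewrite lee_fin f_ge0 // (le_trans hn0).
- exact: mf.
- by move=> x /=; rewrite in_itv/= lee_fin => /andP[_ /ltW]; exact: f_noninc.
Qed.

Lemma integral_expRN : (\int[mu]_(x in `[0%R, +oo[) (expR (- x))%:E = 1)%E.
Proof.
rewrite -(integral_exponential_pdf (@ltr01 R)) integral_mkcond.
apply: eq_integral => x _; rewrite /exponential_pdf /patch /=.
by case: ifP => //; rewrite mul1r mulN1r.
Qed.

(** The integrand of [b], with the opposite sign: minus the logarithm of the
    probability that a clock of rate [exp y] has rung at time [ln 2]. *)
Definition miss_cost (y : R) : R := - ln (1 - 2 `^ (- expR y)).

Lemma pow2NexpE (y : R) : 2 `^ (- expR y) = expR (- (ln 2 * expR y)).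
Proof. by rewrite /powR pnatr_eq0 /= mulNr mulrC. Qed.

Lemma ln2_gt0 : 0 < ln (2 : R).
Proof. by rewrite ln_gt0 // ltr1n. Qed.

Lemma pow2Nexp_lt1 (y : R) : 2 `^ (- expR y) < 1.
Proof.
by rewrite pow2NexpE -[ltRHS]expR0 ltr_expR oppr_lt0 mulr_gt0 ?ln2_gt0 ?expR_gt0.
Qed.

Lemma miss_cost_ge0 (y : R) : 0 <= miss_cost y.
Proof. by rewrite oppr_ge0 ln_le0 // gerBl powR_ge0. Qed.

Lemma expR_miss_cost (y : R) : expR (- miss_cost y) = 1 - 2 `^ (- expR y).
Proof. by rewrite opprK lnK // posrE subr_gt0 pow2Nexp_lt1. Qed.

Lemma miss_cost_noninc : {homo miss_cost : x y /~ y <= x}.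
Proof.
move=> x y xy; rewrite lerN2 ler_ln ?posrE ?subr_gt0 ?pow2Nexp_lt1 //.
by rewrite lerB // !pow2NexpE ler_expR lerN2 ler_pM2l ?ln2_gt0 // ler_expR.
Qed.

Lemma measurable_miss_cost (D : set R) :
  measurable_fun D (EFin \o miss_cost).
Proof.
apply/measurable_EFinP; apply: measurable_funTS.
exact: (@nonincreasing_measurable R setT miss_cost measurableT miss_cost_noninc).
Qed.

(** For [x = 2 ^ (- exp y)], at most [1 / 2], one has [- ln (1 - x) <= 2 * x],
    and [exp (- u) <= 1 / u] at [u = ln 2 * exp y] bounds [x]. *)
Lemma miss_cost_le (y : R) : 0 <= y -> miss_cost y <= 2 / ln 2 * expR (- y).
Proof.
move=> y0; set x := 2 `^ (- expR y).
have x0 : 0 < x by rewrite powR_gt0.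
have xh : x <= 2^-1.
  rewrite /x pow2NexpE -[leRHS]lnK ?posrE ?invr_gt0 // ler_expR lnV ?posrE //.
  by rewrite lerN2 ler_peMr ?(ltW ln2_gt0) // -[leLHS]expR0 ler_expR.
have x1 : 0 < 1 - x by lra.
apply: (@le_trans _ _ (2 * x)).
  rewrite /miss_cost -/x -lnV ?posrE //.
  have -> : (1 - x)^-1 = 1 + x / (1 - x) by field; lra.
  apply: le_trans (le_ln1Dx _) _.
    by apply: (@lt_le_trans _ _ 0) => //; rewrite divr_ge0 ?ltW.
  rewrite ler_pdivrMr //; nra.
rewrite -mulrA ler_pM2l // /x pow2NexpE !expRN -invfM lef_pV2 ?posrE.
- apply: ltW; apply: le_lt_trans (expR_gt1Dx _);
    by rewrite ?lerDr ?gt_eqF ?mulr_gt0 ?ln2_gt0 ?expR_gt0.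
- exact: expR_gt0.
- by rewrite mulr_gt0 ?ln2_gt0 ?expR_gt0.
Qed.

(** Finiteness matters: the real-valued integral in [b_const] would be [0] if
    the extended one were infinite, and [b_const] would bound nothing. *)
Lemma integral_miss_cost_fin :
  (\int[mu]_(y in `[0%R, +oo[) (miss_cost y)%:E)%E \is a fin_num.
Proof.
rewrite ge0_fin_numE; last first.
  by apply: integral_ge0 => y _; rewrite lee_fin miss_cost_ge0.
have mexp : measurable_fun (`[0%R, +oo[%classic : set R)
    (EFin \o (fun x => expR (- x))).
  apply/measurable_EFinP; apply: measurable_funTS.
  exact: measurableT_comp.
have c0 : 0 <= 2 / ln (2 : R) by rewrite divr_ge0 // ltW ?ln2_gt0.
apply: (@le_lt_trans _ _ ((2 / ln (2 : R))%:E *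
  \int[mu]_(x in `[0%R, +oo[) (expR (- x))%:E)%E); last first.
  by rewrite integral_expRN mule1 ltry.
have exp_ge0 (x : R) : `[0%R, +oo[%classic x -> (0 <= (expR (- x))%:E)%E.
  by rewrite lee_fin expR_ge0.
rewrite -(ge0_integralZl_EFin mu _ exp_ge0 mexp c0) //.
apply: ge0_le_integral => //.
- by move=> y _; rewrite lee_fin miss_cost_ge0.
- exact: measurable_miss_cost.
- exact: emeasurable_funM.
- by move=> y /=; rewrite in_itv/= andbT -EFinM lee_fin => /miss_cost_le.
Qed.

Lemma b_constE : b_const R =
  ln 2 + fine (\int[mu]_(y in `[0%R, +oo[) (miss_cost y)%:E)%E.
Proof.
rewrite /b_const /Rintegral; congr (_ + _).
have cost_ge0 (y : R) : `[0%R, +oo[%classic y -> (0 <= (miss_cost y)%:E)%E.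
  by rewrite lee_fin miss_cost_ge0.
rewrite -[in RHS](oppeK (\int[mu]_(y in `[0%R, +oo[) (miss_cost y)%:E)%E).
rewrite -(integral_ge0N mu cost_ge0) fineN; congr (- fine _).
by apply: eq_integral => y _; rewrite -EFinN opprK.
Qed.

Lemma b_const_ge_sum (h : R) (n : nat) : 0 < h ->
  \sum_(j < n) h * miss_cost (h * j.+1%:R) <= b_const R - ln 2.
Proof.
move=> h0; rewrite b_constE addrAC subrr add0r -lee_fin.
rewrite fineK ?integral_miss_cost_fin //.
apply: le_trans (lower_sum_le_integral _ h0 miss_cost_noninc _) _.
  by move=> x _; exact: miss_cost_ge0.
apply: ge0_subset_integral => //.
- exact: measurable_miss_cost.
- by move=> y _; rewrite lee_fin miss_cost_ge0.
- by move=> y /=; rewrite !in_itv/= andbT => /andP[].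
Qed.

Lemma b_const_gt0 : 0 < b_const R.
Proof.
have := b_const_ge_sum 0 (@ltr01 R); rewrite big_ord0 subr_ge0.
exact: lt_le_trans ln2_gt0.
Qed.
End integrals.

(** * A supersolution for the tail of the first block *)

Section potential.
Context {R : realType} (p : R) (n : nat).
Context (p01 : 0 < p < 1).

Definition success : R := expR (- b_const R / p).
Definition hazard : R := p * success.
(** An index [i : 'I_n] stands for the value [i.+1]. *)
Definition weight (i : 'I_n) : R := p * (1 - p) ^+ i.

Let p_gt0 : 0 < p. Proof. by case/andP: p01. Qed.
Let onem_p_gt0 : 0 < 1 - p. Proof. by rewrite subr_gt0; case/andP: p01. Qed.

Lemma weight_gt0 (i : 'I_n) : 0 < weight i.
Proof. by rewrite mulr_gt0 ?exprn_gt0. Qed.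

Lemma success_lt1 : success < 1.
Proof. by rewrite expR_lt1 mulNr oppr_lt0 divr_gt0 // b_const_gt0. Qed.

Lemma hazard_bounds : 0 < hazard < 1.
Proof.
rewrite mulr_gt0 ?expR_gt0 //= (lt_trans _ success_lt1) //.
by rewrite gtr_pMl ?expR_gt0 //; case/andP: p01.
Qed.

Lemma exprn_onem_le (k : nat) : (1 - p) ^+ k <= expR (- (p * k%:R)).
Proof.
rewrite -mulNr expRM_natr lerXn2r ?nnegrE ?expR_ge0 ?(ltW onem_p_gt0) //.
exact: expR_ge1Dx.
Qed.

(** Here [m] is the current maximum and [A] the set of the missing values below
    it.  With [s = ln 2 / (p * (1 - p) ^+ m)] in [race_ge], the missing value
    [i.+1] has rate [p * (1 - p) ^+ i], so it is missed by time [s] with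
    probability [2 ^ (- (1 - p) ^ (- (m - i)))], at most
    [2 ^ (- exp (p * (m - i)))]. *)
Lemma race_ge_success (m : nat) (A : {set 'I_n}) : (m <= n)%N ->
  (forall i, i \in A -> (i < m)%N) ->
  success <= race weight ((1 - p) ^+ m) A.
Proof.
move=> mn Am; pose s := ln 2 / (p * (1 - p) ^+ m).
have pm_gt0 : 0 < (1 - p) ^+ m by rewrite exprn_gt0.
have s0 : 0 <= s by rewrite divr_ge0 ?mulr_ge0 ?ltW ?ln2_gt0.
apply: le_trans (race_ge weight_gt0 pm_gt0 A s0).
have -> : (1 - p) ^+ m * s = ln 2 / p.
  by rewrite /s; field; rewrite !gt_eqF.
have cost_le :
    \sum_(i in A) miss_cost (p * (m - i)%:R) <= (b_const R - ln 2) / p.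
  rewrite ler_pdivlMr // mulrC; apply: le_trans (b_const_ge_sum m p_gt0).
  rewrite -mulr_sumr ler_pM2l //.
  (* The distances [m - i] of the elements of [A] are distinct elements of
     [{1, ..., m}]. *)
  rewrite [leRHS](reindex_inj rev_ord_inj) /=.
  rewrite (big_ord_widen _ (fun i => miss_cost (p * (m - i.+1).+1%:R)) mn).
  rewrite [leLHS]big_mkcond [leRHS]big_mkcond; apply: ler_sum => i _.
  case: ifP => [/Am im|_]; last by case: ifP => // _; exact: miss_cost_ge0.
  by rewrite im subnSK.
apply: (@le_trans _ _ (expR (- (ln 2 / p)) *
    expR (- \sum_(i in A) miss_cost (p * (m - i)%:R)))).
  rewrite -expRD ler_expR -opprD mulNr lerN2.
  apply: le_trans (lerD (lexx _) cost_le) _.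
  by rewrite -mulrDl addrC subrK.
rewrite ler_pM2l ?expR_gt0 // -sumrN expR_sum; apply: ler_prod => i iA.
rewrite expR_ge0 /= expR_miss_cost pow2NexpE lerB // ler_expR lerN2.
have im := Am _ iA.
have -> : weight i * s = ln 2 / (1 - p) ^+ (m - i).
  have mE : (1 - p) ^+ m = (1 - p) ^+ i * (1 - p) ^+ (m - i).
    by rewrite -exprD subnKC // ltnW.
  by rewrite /weight /s mE; field; rewrite !expf_neq0 ?gt_eqF.
rewrite ler_pM2l ?ln2_gt0 // -[leLHS]invrK -expRN.
rewrite lef_pV2 ?posrE ?expR_gt0 ?exprn_gt0 //.
exact: exprn_onem_le.
Qed.

Lemma sum_geometric (m : nat) :
  \sum_(i < m) p * (1 - p) ^+ i = 1 - (1 - p) ^+ m.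
Proof.
elim: m => [|m IHm]; first by rewrite big_ord0 expr0 subrr.
by rewrite big_ord_recr /= IHm exprS; ring.
Qed.

(** The tail recursion of [Geo(p * r)] seen as a [Geo(r)] number of [Geo(p)]
    steps: the next maximum after [m] either exceeds [m + k], or falls on
    [i.+1], fails with probability [1 - r], and leaves [m + k - i.+1] values to
    overshoot. *)
Lemma sum_overshoot_nat (m k : nat) :
  \sum_(m <= i < m + k) p * (1 - p) ^+ i *
     ((1 - success) * (1 - hazard) ^+ (m + k - i.+1)) + (1 - p) ^+ (m + k) =
  (1 - p) ^+ m * (1 - hazard) ^+ k.
Proof.
elim: k m => [|k IHk] m.
  by rewrite addn0 big_geq // add0r mulr1.
rewrite big_ltn ?addnS ?ltnS ?leq_addr // subSS addnC addnK.
by rewrite -addrA addnC -addSn IHk /hazard !exprS; ring.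
Qed.

Lemma sum_overshoot (m : nat) : (m <= n)%N ->
  \sum_(i < n | (m <= i)%N) weight i *
     ((1 - success) * (1 - hazard) ^+ (n - i.+1)) + (1 - p) ^+ n =
  (1 - p) ^+ m * (1 - hazard) ^+ (n - m).
Proof.
move=> mn; rewrite -sum_overshoot_nat subnKC // big_geq_mkord /=.
by congr (_ + _).
Qed.

Definition top (S : {set 'I_n}) : nat := \max_(i in S) i.+1.
Definition missing (S : {set 'I_n}) : {set 'I_n} :=
  [set i : 'I_n | (i < top S)%N] :\: S.

(** A bound on the conditional probability that the first block is larger than
    [n] when [S] is the set of the values seen so far.  For nonempty [S] the
    current maximum must fail, with probability one minus [race]; the remaining
    [n - top S] values are then overshot with the tail of the dominating
    geometric law.  Before the first draw there is nothing to fail. *)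
Definition potential (S : {set 'I_n}) : R :=
  (if S == finset.set0 then 1
   else 1 - race weight ((1 - p) ^+ top S) (missing S)) *
  (1 - hazard) ^+ (n - top S).

Lemma top_le (S : {set 'I_n}) : (top S <= n)%N.
Proof. by apply/bigmax_leqP => i _. Qed.

Lemma ltn_top (S : {set 'I_n}) i : i \in S -> (i < top S)%N.
Proof. by move=> iS; rewrite /top (bigD1 i) //= leq_maxl. Qed.

Lemma setU1_mem (S : {set 'I_n}) i : i \in S -> i |: S = S.
Proof. by move=> iS; apply/finset.setUidPr; rewrite finset.sub1set. Qed.

Lemma top_setU1 (S : {set 'I_n}) i : top (i |: S) = maxn i.+1 (top S).
Proof.
have [iS|iS] := boolP (i \in S); last by rewrite /top big_setU1.
rewrite setU1_mem //.
by apply/esym/maxn_idPr; exact: ltn_top.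
Qed.

Lemma missing_lt_top (S : {set 'I_n}) i : i \in missing S -> (i < top S)%N.
Proof. by rewrite !inE => /andP[]. Qed.

Lemma missing_setU1 (S : {set 'I_n}) (i : 'I_n) : (i < top S)%N ->
  missing (i |: S) = missing S :\ i.
Proof.
move=> iS; apply/setP => j; rewrite !inE top_setU1 (maxn_idPr iS).
by rewrite negb_or -andbA.
Qed.

Let pX_gt0 k : 0 < (1 - p) ^+ k. Proof. by rewrite exprn_gt0. Qed.

Lemma onem_hazard_ge0 : 0 <= 1 - hazard.
Proof. by rewrite subr_ge0 ltW //; case/andP: hazard_bounds. Qed.

Lemma potential_ge0 (S : {set 'I_n}) : 0 <= potential S.
Proof.
apply: mulr_ge0; last by rewrite exprn_ge0 ?onem_hazard_ge0.
case: ifP => // _; rewrite subr_ge0.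
by have /andP[] := race_bounds weight_gt0 (pX_gt0 (top S)) (missing S).
Qed.

Lemma potential_new_top (S : {set 'I_n}) (i : 'I_n) : (top S <= i)%N ->
  potential (i |: S) <= (1 - success) * (1 - hazard) ^+ (n - i.+1).
Proof.
move=> Si; rewrite /potential top_setU1 (maxn_idPl (leqW Si)).
have -> : (i |: S == finset.set0) = false.
  by apply/negbTE/set0Pn; exists i; rewrite setU11.
rewrite ler_wpM2r ?exprn_ge0 ?onem_hazard_ge0 // lerB // race_ge_success //.
by move=> j /missing_lt_top; rewrite top_setU1 (maxn_idPl (leqW Si)).
Qed.

Lemma sum_weight_top (S : {set 'I_n}) :
  \sum_(i in missing S) weight i + \sum_(i in S) weight i =
  1 - (1 - p) ^+ top S.
Proof.
rewrite -sum_geometric (big_ord_widen _ (fun i => p * (1 - p) ^+ i) (top_le S)).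
rewrite [RHS](bigID [in S]) /= addrC; congr (_ + _); apply: eq_bigl => i.
  by rewrite !inE andbC.
by case: (boolP (i \in S)) => [/ltn_top ->|]; rewrite ?andbF.
Qed.

(** The next draw repeats a value of [S], hits a missing value, or produces a
    new maximum, possibly above [n].  By [race_rec] the potential is harmonic
    for the first two kinds of draws together with the failure of [top S], and
    [sum_overshoot] accounts for what follows the failure.  If [S] is a completed
    block, its potential is [0] and the inequality is false, whence the
    hypothesis. *)
Lemma potential_super (S : {set 'I_n}) :
  S = finset.set0 \/ missing S != finset.set0 ->
  \sum_(i < n) weight i * potential (i |: S) + (1 - p) ^+ n <= potential S.
Proof.
move=> S_open; rewrite (bigID (fun i : 'I_n => (top S <= i)%N)) /= addrAC.
apply: (@le_trans _ _ ((1 - p) ^+ top S * (1 - hazard) ^+ (n - top S) +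
   \sum_(i < n | ~~ (top S <= i)%N) weight i * potential (i |: S))).
  rewrite lerD2r -(sum_overshoot (top_le S)) lerD2r.
  apply: ler_sum => i Si.
  by rewrite ler_wpM2l ?potential_new_top // ltW ?weight_gt0.
have [S0|S0] := eqVneq S finset.set0.
  rewrite S0 /potential eqxx big_pred0 /top; last first.
    by move=> i; rewrite big_set0.
  by rewrite big_set0 expr0 addr0.
have {S_open} miss0 : missing S != finset.set0.
  by case: S_open => // S0'; rewrite S0' eqxx in S0.
rewrite (bigID [in S]) /=.
set D := (1 - hazard) ^+ (n - top S); set w0 := (1 - p) ^+ top S.
have -> : \sum_(i < n | ~~ (top S <= i)%N && (i \in S))
     weight i * potential (i |: S) =
   (\sum_(i in S) weight i) * potential S.
  rewrite mulr_suml; apply: eq_big => i.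
    rewrite -ltnNge.
    by case: (boolP (i \in S)) => [/ltn_top ->|]; rewrite ?andbF.
  by move=> /andP[_ iS]; rewrite setU1_mem.
have -> : \sum_(i < n | ~~ (top S <= i)%N && (i \notin S))
     weight i * potential (i |: S) =
   (\sum_(i in missing S) weight i -
     \sum_(i in missing S) weight i * race weight w0 (missing S :\ i)) * D.
  rewrite -sumrB mulr_suml; apply: eq_big => i.
    by rewrite -ltnNge !inE andbC.
  rewrite -ltnNge => /andP[iS _]; rewrite /potential top_setU1 (maxn_idPr iS).
  have -> : (i |: S == finset.set0) = false.
    by apply/negbTE/set0Pn; exists i; rewrite setU11.
  by rewrite missing_setU1 // -/D -/w0; ring.
rewrite -(race_rec weight_gt0 (pX_gt0 _) miss0).
rewrite /potential (negbTE S0) -/w0 -/D.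
have -> : \sum_(i in S) weight i = 1 - w0 - \sum_(i in missing S) weight i.
  by rewrite -(sum_weight_top S) addrAC subrr add0r.
by rewrite le_eqVlt; apply/orP; left; apply/eqP; ring.
Qed.

End potential.

(** * The first block of a sequence *)

Definition distinct (x : nat -> nat) (n : nat) : nat := size (undup (mkseq x n)).

Definition new_at (x : nat -> nat) (k n : nat) : Prop :=
  x n \notin mkseq x n /\ distinct x n.+1 = k.

Lemma distinctS (x : nat -> nat) n :
  distinct x n.+1 = (distinct x n + (x n \notin mkseq x n))%N.
Proof.
rewrite /distinct mkseqS (perm_size (perm_undup (mem_rcons _ _))) /=.
by case: (x n \in mkseq x n); rewrite ?addn0 ?addn1.
Qed.

Lemma leq_distinct (x : nat -> nat) : {homo distinct x : m n / (m <= n)%N}.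
Proof.
apply: homo_leq => [//|m n k|n]; first exact: leq_trans.
by rewrite distinctS leq_addr.
Qed.

Lemma distinct_new (x : nat -> nat) n :
  x n \notin mkseq x n -> distinct x n.+1 = (distinct x n).+1.
Proof. by move=> xn; rewrite distinctS xn addn1. Qed.

Lemma new_at_inj (x : nat -> nat) k m n : new_at x k m -> new_at x k n -> m = n.
Proof.
wlog mn : m n / (m <= n)%N.
  move=> W; case: (leqP m n) => [/W//|/ltnW nm Hm Hn].
  by rewrite (W _ _ nm Hn Hm).
move=> [_ mk] [xn nk]; apply/eqP; rewrite eqn_leq mn /= leqNgt; apply/negP.
move=> /(leq_distinct x); rewrite mk -nk distinct_new //.
by rewrite ltnn.
Qed.

Lemma values_in_orderE (x : nat -> nat) k n :
  new_at x k n -> values_in_order x k = x n.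
Proof.
move=> kn; apply: xget_unique; first by exists n.
by move=> _ [m km <-]; rewrite (new_at_inj km kn).
Qed.

Lemma values_in_order_new (x : nat -> nat) k : values_in_order x k != 0%N ->
  exists2 n, new_at x k n & values_in_order x k = x n.
Proof.
rewrite /values_in_order.
case: xgetP => [_ -> [n nk <-] _|_]; last by rewrite eqxx.
by exists n.
Qed.

Lemma first_occurrence (x : nat -> nat) (v t : nat) : v \in mkseq x t ->
  exists2 n, (n < t)%N & x n = v /\ x n \notin mkseq x n.
Proof.
elim: t => [//|t IHt]; have [vt _|vt] := boolP (v \in mkseq x t).
  by have [n nt xn] := IHt vt; exists n => //; exact: ltnW.
by rewrite mkseqS mem_rcons inE (negbTE vt) orbF => /eqP vE; exists t; rewrite -?vE.
Qed.

Lemma new_at_exists (x : nat -> nat) k t : (0 < k <= distinct x t)%N ->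
  exists2 n, (n < t)%N & new_at x k n.
Proof.
elim: t => [|t IHt]; first by case: k.
case/andP=> k0; have [kt _|kt] := leqP k (distinct x t).
  have [|n nt kn] := IHt; first by rewrite k0.
  by exists n => //; exact: ltnW.
rewrite distinctS; case xt : (x t \in mkseq x t) => /=.
  by rewrite addn0 leqNgt kt.
rewrite addn1 => kt'; exists t => //; split; first by rewrite xt.
by rewrite distinct_new ?xt //; apply/eqP; rewrite eqn_leq kt.
Qed.

Definition sees_block (x : nat -> nat) (k : nat) : Prop :=
  exists t, mkseq x t =i iota 1 k.

(** This turns the condition on the distinct values in order of appearance into
    a condition on finitely many draws at a time, which is what gives
    measurability. *)
Lemma block_seen (x : nat -> nat) (k : nat) : (0 < k)%N ->
  values_in_order x @` one_to k = one_to k <-> sees_block x k.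
Proof.
move=> k0; split=> [img|[t xt]].
  have img_v j : (0 < j <= k)%N -> (0 < values_in_order x j <= k)%N.
    move=> jk; have : one_to k (values_in_order x j) by rewrite -img; exists j.
    exact.
  have [|n [xn nk] _] := @values_in_order_new x k.
    by have := img_v k; rewrite k0 leqnn => /(_ isT) /andP[]; rewrite lt0n.
  exists n.+1.
  have sub : {subset undup (mkseq x n.+1) <= iota 1 k}.
    move=> v; rewrite mem_undup => /first_occurrence[m mn [<- xm]].
    rewrite mem_iota add1n ltnS.
    rewrite -(@values_in_orderE x (distinct x m.+1) m) //; apply: img_v.
    by rewrite -nk leq_distinct // andbT distinct_new.
  have [] := uniq_min_size (undup_uniq _) sub; first by rewrite size_iota -nk.
  by move=> _ E v; rewrite -E mem_undup.
have dt : distinct x t = k.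
  rewrite /distinct (perm_size (perm_undup xt)) undup_id ?iota_uniq //.
  exact: size_iota.
apply/seteqP; split=> [_ [j jk <-]|v vk].
  have [n nt jn] : exists2 n, (n < t)%N & new_at x j n.
    by apply: new_at_exists; rewrite dt.
  have : x n \in iota 1 k.
    by rewrite -xt; apply/mapP; exists n; rewrite // mem_iota.
  by rewrite mem_iota add1n ltnS (values_in_orderE jn).
have : v \in mkseq x t by rewrite xt mem_iota add1n ltnS.
move=> /first_occurrence[n nt [<- xn]].
exists (distinct x n.+1); last by apply: values_in_orderE.
by rewrite /one_to /= -dt leq_distinct // andbT distinct_new.
Qed.

Lemma lt_first_block_size {R : realType} (x : nat -> nat) (n : nat) :
  (n%:R%:E < first_block_size R x)%E <->
  (forall k, (0 < k <= n)%N -> ~ sees_block x k).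
Proof.
rewrite /first_block_size; split=> [nK k /andP[k0 kn] xk|noblock].
  move: nK; rewrite ltNge => /negP; apply.
  apply: (@le_trans _ _ k%:R%:E); last by rewrite lee_fin ler_nat.
  by apply: ereal_inf_lbound; exists k => //; split => //; exact/block_seen.
apply: (@lt_le_trans _ _ n.+1%:R%:E); first by rewrite lte_fin ltr_nat.
apply/ereal_infP => y [k [k0 /block_seen-/(_ k0) xk] <- {y}].
rewrite lee_fin ler_nat ltnNge; apply/negP => kn.
by apply: (noblock k) => //; rewrite k0.
Qed.

Lemma first_block_size_nat {R : realType} (x : nat -> nat) :
  first_block_size R x = +oo%E \/ exists k, first_block_size R x = k%:R%:E.
Proof.
have [[k0 k0B]|nB] := pselect (exists k, (0 < k)%N /\ sees_block x k); last first.
  left; apply/eqP; rewrite -leye_eq; apply/ereal_infP => y [k [k0 kB] _].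
  by exfalso; apply: nB; exists k; split => //; exact/block_seen.
right; have exB : exists k, `[< (0 < k)%N /\ sees_block x k >].
  by exists k0; exact/asboolP.
case: (ex_minnP exB) => k /asboolP[k_gt0 kB] k_min; exists k.
apply/eqP; rewrite eq_le; apply/andP; split.
  by apply: ereal_inf_lbound; exists k => //; split => //; exact/block_seen.
apply/ereal_infP => y [j [j0 /block_seen-/(_ j0) jB] <- {y}].
by rewrite lee_fin ler_nat k_min //; exact/asboolP.
Qed.

(** Integrated over the probability space, this expresses the expectation of an
    integer-valued variable as the sum of its tails. *)
Lemma nat_tail_series {R : realType} (y : \bar R) :
  y = +oo%E \/ (exists k, y = k%:R%:E) ->
  (\sum_(n <oo) ((n%:R%:E < y)%E%:R : R)%:E)%E = y.
Proof.
move=> yE; apply/cvg_lim => //.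
case: yE => [->|[k ->]].
  rewrite (_ : (fun n => _) = (fun n => n%:R%:E)) ?cvgenyP //.
  apply/funext => n; rewrite (eq_bigr (fun=> 1%:E)) ?sumEFin.
    by rewrite big_mkord sumr_const card_ord.
  by move=> i _; rewrite ltry.
apply: cvg_near_cst; near=> n.
rewrite (eq_bigr (fun i : nat => ((i < k)%N%:R)%:E)); last first.
  by move=> i _; rewrite lte_fin ltr_nat.
rewrite sumEFin -natr_sum; congr (_%:R%:E).
have kn : (k <= n)%N by near: n; exact: nbhs_infty_ge.
rewrite (@big_cat_nat _ _ _ k) //= [X in (_ + X)%N]big_nat_cond.
rewrite [X in (_ + X)%N]big1; last first.
  by move=> i /andP[/andP[ki _] _]; rewrite ltnNge ki.
rewrite addn0 big_nat_cond (eq_bigr (fun=> 1%N)); last first.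
  by move=> i /andP[/andP[_ ->]].
by rewrite -big_nat_cond big_mkord sum1_card card_ord.
Unshelve. all: by end_near. Qed.

(** * The geometric law *)

Section geometric_prob_values.
Context {R : realType} (r : R).
Context (r01 : 0 < r < 1).

Lemma geometric_pmf_ge0 k : 0 <= geometric_pmf r k.
Proof.
case/andP: r01 => r0 r1; case: k => [|k] //=.
by rewrite mulr_ge0 ?exprn_ge0 ?subr_ge0 // ltW.
Qed.

Lemma geometric_prob_set1 k :
  geometric_prob r [set k] = (geometric_pmf r k)%:E.
Proof. by rewrite /geometric_prob r01 esum_set1 // lee_fin geometric_pmf_ge0. Qed.

Lemma geometric_tail n :
  geometric_prob r [set k | (n < k)%N] = ((1 - r) ^+ n)%:E.
Proof.
have split m : [set k | (m <= k)%N] = [set m] `|` [set k | (m < k)%N].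
  apply/seteqP; split => k /=.
    by rewrite leq_eqVlt => /predU1P[<-|]; [left|right].
  by case=> [->//|/ltnW].
have step m (y : R) : geometric_prob r [set k | (m <= k)%N] = y%:E ->
    geometric_prob r [set k | (m < k)%N] = (y - geometric_pmf r m)%:E.
  have <- : (geometric_prob r [set m] + geometric_prob r [set k | (m < k)%N] =
      geometric_prob r [set k | (m <= k)%N])%E.
    rewrite (split m) measureU //.
    by apply/seteqP; split => k //= [->]; rewrite ltnn.
  rewrite geometric_prob_set1; move: (geometric_prob r [set k | (m < k)%N]).
  by move=> [z| |] //= [<-]; congr (_%:E); rewrite addrAC subrr add0r.
elim: n => [|n IHn].
  rewrite (step 0%N 1) ?subr0 //.
  rewrite (_ : [set k | (0 <= k)%N] = setT) ?probability_setT //.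
  by apply/seteqP; split.
by rewrite (step n.+1 _ IHn) /= exprS mulrBl mul1r.
Qed.
End geometric_prob_values.

(** * The tail of the first block *)

Section geometric_words.
Context {R : realType} (p : R) d (T : measurableType d) (P : probability T R)
  (X : nat -> {RV P >-> nat}).
Context (p01 : 0 < p < 1) (iidX : iid_geometric X p).

Lemma prob_preimage (j : nat) (U : set nat) :
  P (X j @^-1` U) = geometric_prob p U.
Proof. by case: iidX => _ /(_ j U). Qed.

Definition word_event (s : seq nat) : set T :=
  [set w | mkseq (X^~ w) (size s) = s].

Lemma measurable_preimage (j : nat) (U : set nat) :
  measurable (X j @^-1` U).
Proof. exact: measurable_funPTI. Qed.

Lemma set_iota0 (m : nat) : [set` iota 0 m] = [set j | (j < m)%N].
Proof. by apply/seteqP; split => j /=; rewrite mem_iota. Qed.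

Lemma word_event_bigcap (s : seq nat) :
  word_event s =
  \bigcap_(j in [set` iota 0 (size s)]) (X j @^-1` [set nth 0%N s j]).
Proof.
rewrite set_iota0; apply/seteqP; split => w /= ws.
  by move=> j js /=; rewrite -[in RHS]ws nth_mkseq.
apply: (@eq_from_nth _ 0%N); first by rewrite size_mkseq.
by move=> j; rewrite size_mkseq => js; rewrite nth_mkseq //; exact: ws.
Qed.

Lemma measurable_word_event (s : seq nat) : measurable (word_event s).
Proof.
rewrite word_event_bigcap; apply: fin_bigcap_measurable => //.
by move=> j _; exact: measurable_preimage.
Qed.

(** Independence is used only here: the next draw is independent of the word
    formed by the previous ones. *)
Lemma word_event_next (s : seq nat) (U : set nat) :
  P (word_event s `&` X (size s) @^-1` U) =
  (P (word_event s) * geometric_prob p U)%E.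
Proof.
(* The whole event is an intersection of preimages over the first draws, with
   [U] imposed on the last of them. *)
pose A j := if (j < size s)%N then [set nth 0%N s j] else U.
have eqA : word_event s =
    \bigcap_(j in [set` iota 0 (size s)]) (X j @^-1` A j).
  rewrite word_event_bigcap set_iota0; apply: eq_bigcapr => j /= js.
  by rewrite /A js.
have eqA' : word_event s `&` X (size s) @^-1` U =
    \bigcap_(j in [set` iota 0 (size s).+1]) (X j @^-1` A j).
  rewrite eqA !set_iota0; apply/seteqP; split => w.
    move=> [ws wU] j /=; rewrite ltnS leq_eqVlt.
    by move=> /predU1P[->|]; [rewrite /A ltnn | exact: ws].
  move=> ws; split; last by have := ws (size s) (ltnSn _); rewrite /A ltnn.
  by move=> j /= js; apply: ws; exact: ltnW.
have [indep _] := iidX.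
rewrite eqA' eqA !indep ?iota_uniq //.
rewrite -addn1 iotaD big_cat /= big_seq1 add0n; congr (_ * _)%E.
by rewrite /A ltnn prob_preimage.
Qed.

Lemma word_event_rcons (s : seq nat) (v : nat) :
  word_event (rcons s v) = word_event s `&` X (size s) @^-1` [set v].
Proof.
apply/seteqP; split => w; rewrite /word_event /= size_rcons mkseqS.
  by move=> /rcons_inj[].
by move=> [-> ->].
Qed.

Local Notation K w := (first_block_size R (X^~ w)).

Definition tail_event (n : nat) : set T := [set w | (n%:R%:E < K w)%E].

(** Seeing a block depends on a finite prefix of the draws, and there are
    countably many finite words. *)
Lemma measurable_sees_block (k : nat) :
  measurable [set w | sees_block (X^~ w) k].
Proof.
have -> : [set w | sees_block (X^~ w) k] =
    \bigcup_s (if s \in [pred s | perm_eq (undup s) (iota 1 k)]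
               then word_event s else set0).
  apply/seteqP; split => w /=.
    move=> [t xt]; exists (mkseq (X^~ w) t) => //.
    rewrite inE (_ : perm_eq _ _); last first.
      apply: uniq_perm; rewrite ?undup_uniq ?iota_uniq // => v.
      by rewrite mem_undup xt.
    by rewrite /word_event /= size_mkseq.
  move=> [s _]; rewrite inE; case: ifP => // /perm_mem sE ws.
  by exists (size s) => v; rewrite ws -sE mem_undup.
apply: countable_bigcupT_measurable; first exact: countableP.
by move=> s; case: ifP => // _; exact: measurable_word_event.
Qed.

Lemma measurable_tail_event (n : nat) : measurable (tail_event n).
Proof.
have -> : tail_event n =
    ~` \bigcup_(k in [set k | (0 < k <= n)%N]) [set w | sees_block (X^~ w) k].
  apply/seteqP; split => w /=.
    by move=> /lt_first_block_size nb [k /= kn]; exact: nb.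
  by move=> nb; apply/lt_first_block_size => k kn kB; apply: nb; exists k.
apply: measurableC; apply: bigcup_measurable => k _.
exact: measurable_sees_block.
Qed.

Section words_below.
Variable n : nat.
Implicit Types s : seq 'I_n.

Definition word_values s : seq nat := [seq (val i).+1 | i <- s].

Lemma block_word s :
  s != [::] -> missing [set i | i \in s]%SET = finset.set0 ->
  word_event (word_values s) `&` tail_event n = set0.
Proof.
move=> s0 miss0; set S := [set i | i \in s]%SET in miss0.
apply/seteqP; split => w //= [ws /lt_first_block_size].
have S0 : (0 < top S)%N.
  case: s s0 @S miss0 {ws} => // i s _ S _.
  by apply: leq_ltn_trans (ltn_top (_ : i \in S)) => //; rewrite !inE eqxx.
move=> /(_ (top S)); rewrite S0 top_le => /(_ isT); apply.
exists (size (word_values s)) => v; rewrite ws mem_iota add1n ltnS.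
apply/mapP/idP => [[i iS ->]|/andP[v0 vS]].
  by rewrite /= ltn_top // inE.
have vn : (v.-1 < n)%N by rewrite prednK // (leq_trans vS) // top_le.
exists (Ordinal vn); last by rewrite /= prednK.
have : Ordinal vn \notin missing S by rewrite miss0 inE.
by rewrite !inE /= prednK // vS andbT negbK.
Qed.

Lemma word_values_rcons s i :
  word_values (rcons s i) = rcons (word_values s) i.+1.
Proof. by rewrite /word_values map_rcons. Qed.

(** The next draw is one of the values [1, ..., n], or exceeds [n], or is [0];
    the last case has probability [0]. *)
Lemma tail_word s : (P (word_event (word_values s) `&` tail_event n) <=
  \sum_(i < n) P (word_event (word_values (rcons s i)) `&` tail_event n) +
  P (word_event (word_values s)) * ((1 - p) ^+ n)%:E)%E.
Proof.
set W := word_event _; set U := [set 0%N] `|` [set k | (n < k)%N].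
pose B (i : nat) := word_event (rcons (word_values s) i.+1) `&` tail_event n.
have mB i : measurable (B i).
  apply: measurableI; first exact: measurable_word_event.
  exact: measurable_tail_event.
have mB' : measurable (\big[setU/set0]_(i < n) B i) by apply: bigsetU_measurable.
have mU : measurable (W `&` X (size (word_values s)) @^-1` U).
  by apply: measurableI; [exact: measurable_word_event|exact: measurable_preimage].
apply: (@le_trans _ _ (P (\big[setU/set0]_(i < n) B i `|`
    (W `&` X (size (word_values s)) @^-1` U)))).
  apply: le_measure; rewrite ?inE.
  - apply: measurableI; first exact: measurable_word_event.
    exact: measurable_tail_event.
  - exact: measurableU.
  move=> w [Ww nw]; case Xw : (X (size (word_values s)) w) => [|v].
    by right; split => //; left.
  have [vn|nv] := ltnP v n; last first.
    by right; split => //; right; rewrite /= Xw ltnS.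
  left; rewrite -bigcup_mkord; exists v => //; split => //.
  by rewrite word_event_rcons.
apply: (@le_trans _ _ (P (\big[setU/set0]_(i < n) B i) +
    P (W `&` X (size (word_values s)) @^-1` U))%E); first exact: measureU2.
apply: leeD.
  apply: le_trans (Boole_inequality _ (fun i _ => mB i)) _.
  by apply: lee_sum => i _; rewrite word_values_rcons.
rewrite word_event_next; apply: lee_wpmul2l => //.
apply: (@le_trans _ _ (geometric_prob p [set 0%N] +
  geometric_prob p [set k | (n < k)%N])%E); first exact: measureU2.
by rewrite (geometric_prob_set1 p01) (geometric_tail p01) add0e.
Qed.

Lemma word_event_prob_rcons s i :
  P (word_event (word_values (rcons s i))) =
  (P (word_event (word_values s)) * (weight p i)%:E)%E.
Proof.
rewrite word_values_rcons word_event_rcons word_event_next.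
by rewrite geometric_prob_set1.
Qed.

(** By induction on [t], the number of draws that are looked at.  Either the word
    has completed a block, and the event is empty, or [potential_super] applies.
    The extra term accounts for the event that the next [t] draws are all at most
    [n]: at [t = 0] it is [1] and the bound is trivial. *)
Lemma tail_potential (t : nat) s :
  (P (word_event (word_values s) `&` tail_event n) <=
   P (word_event (word_values s)) *
     (potential p [set i | i \in s]%SET + (1 - (1 - p) ^+ n) ^+ t)%:E)%E.
Proof.
have beta_ge0 : 0 <= 1 - (1 - p) ^+ n.
  have /andP[p0 p1] := p01.
  by rewrite subr_ge0 exprn_ile1 ?subr_ge0 ?(ltW p1) // gerBl ltW.
elim: t s => [|t IHt] s.
  apply: (@le_trans _ _ (P (word_event (word_values s)))).
    apply: le_measure; rewrite ?inE; last by move=> w [].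
      apply: measurableI; first exact: measurable_word_event.
      exact: measurable_tail_event.
    exact: measurable_word_event.
  rewrite -[leLHS]mule1; apply: lee_wpmul2l => //.
  by rewrite lee_fin expr0 lerDr potential_ge0.
set S := [set i | i \in s]%SET.
have [/andP[s0 /eqP miss0]|] :=
    boolP ((s != [::]) && (missing S == finset.set0)).
  rewrite block_word // measure0 mule_ge0 // lee_fin.
  by rewrite addr_ge0 ?exprn_ge0 ?potential_ge0.
rewrite negb_and negbK => S_open.
have {}S_open : S = finset.set0 \/ missing S != finset.set0.
  case/orP: S_open => [/eqP s0|]; [left|by right].
  by apply/setP => i; rewrite !inE s0.
apply: le_trans (tail_word s) _.
have Pfin : P (word_event (word_values s)) \is a fin_num.
  by apply: fin_num_measure; exact: measurable_word_event.
set c := fine (P (word_event (word_values s))).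
have c0 : 0 <= c by rewrite fine_ge0.
have cE : P (word_event (word_values s)) = c%:E by rewrite fineK.
rewrite cE.
apply: (@le_trans _ _ (c * (\sum_(i < n) weight p i *
   (potential p (i |: S) + (1 - (1 - p) ^+ n) ^+ t) + (1 - p) ^+ n))%:E); last first.
  rewrite lee_fin ler_wpM2l //.
  under eq_bigr do rewrite mulrDr.
  rewrite big_split /= -mulr_suml (sum_geometric p n) exprS addrAC lerD2r.
  exact: potential_super.
rewrite mulrDr EFinD -EFinM; apply: leeD => //.
rewrite mulr_sumr -sumEFin; apply: lee_sum => i _.
apply: le_trans (IHt _) _; rewrite word_event_prob_rcons cE -!EFinM lee_fin.
rewrite -mulrA (_ : [set j | j \in rcons s i]%SET = i |: S) //.
by apply/setP => j; rewrite !inE mem_rcons inE.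
Qed.

(** The extra term of [tail_potential] tends to [0] with [t]; the empty word has
    the potential [(1 - hazard p) ^+ n]. *)
Lemma tail_event_le : (P (tail_event n) <= ((1 - hazard p) ^+ n)%:E)%E.
Proof.
have /andP[p0 p1] := p01.
have fin : P (tail_event n) \is a fin_num.
  by apply: fin_num_measure; exact: measurable_tail_event.
rewrite -(fineK fin) lee_fin; apply/ler_addgt0Pr => e e0.
have beta1 : `|1 - (1 - p) ^+ n| < 1.
  have pn_gt0 : 0 < (1 - p) ^+ n by rewrite exprn_gt0 // subr_gt0.
  have pn_le1 : (1 - p) ^+ n <= 1.
    by rewrite exprn_ile1 ?subr_ge0 ?(ltW p1) // gerBl ltW.
  by rewrite ger0_norm ?subr_ge0 // gtrBl.
have /cvgrPdist_lt/(_ e e0)[t _ /(_ t (leqnn t))] := cvg_expr beta1.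
rewrite sub0r normrN => /= te.
apply: (@le_trans _ _ ((1 - hazard p) ^+ n + (1 - (1 - p) ^+ n) ^+ t)); last first.
  by rewrite lerD2l; apply: le_trans (ler_norm _) (ltW te).
rewrite -lee_fin fineK //; have := tail_potential t [::].
have -> : word_event (word_values [::]) = setT by apply/seteqP; split.
rewrite setTI probability_setT mul1e (_ : [set i | i \in [::]]%SET = finset.set0).
  by rewrite /potential eqxx mul1r /top big_set0 subn0.
by apply/setP => i; rewrite !inE.
Qed.
End words_below.

End geometric_words.

(** * Domination, expectation and asymptotics *)

Lemma ltr_trunc_nat {R : realType} (x : R) (k : nat) : 0 <= x ->
  (x < k%:R) = (Num.trunc x < k)%N.
Proof.
move=> x0; case: k => [|k]; first by rewrite ltNge x0 ltn0.
by rewrite ltnS truncn_le_nat.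
Qed.

Section conclusions.
Context {R : realType} (p : R) d (T : measurableType d) (P : probability T R)
  (X : nat -> {RV P >-> nat}).
Context (p01 : 0 < p < 1) (iidX : iid_geometric X p).
Local Notation K w := (first_block_size R (fun n => X n w)).

Lemma tail_event_real (x : R) : 0 <= x ->
  [set w | (x%:E < K w)%E] = tail_event X (Num.trunc x).
Proof.
move=> x0; apply/eq_set => w; congr is_true.
case: (first_block_size_nat (R := R) (fun n => X n w)) => [->|[k ->]].
  by rewrite !ltry.
by rewrite !lte_fin ltr_nat ltr_trunc_nat.
Qed.

Lemma expectation_first_block_size :
  (\int[P]_w K w <= ((hazard p)^-1)%:E)%E.
Proof.
have /andP[q0 q1] := hazard_bounds p01.
have -> : (fun w => K w) =
    (fun w => \sum_(n <oo) (\1_(tail_event X n) w)%:E)%E.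
  apply/funext => w; rewrite -[LHS]nat_tail_series; last first.
    exact: first_block_size_nat.
  apply: eq_eseriesr => n _; rewrite indicE; congr ((nat_of_bool _)%:R%:E).
  by apply/idP/idP; rewrite inE.
have mE n := measurable_tail_event X n.
rewrite integral_nneseries //; last first.
  by move=> n; apply/measurable_EFinP; exact: measurable_indic.
apply: (@le_trans _ _ (\sum_(n <oo) ((1 - hazard p) ^+ n)%:E)%E).
  apply: lee_nneseries => n _.
    by move=> _; apply: integral_ge0 => w _; rewrite lee_fin.
  by rewrite integral_indic // setIT; exact: tail_event_le.
rewrite (_ : (\sum_(n <oo) _)%E = ((hazard p)^-1)%:E) //.
apply/cvg_lim => //.
rewrite (_ : (fun n => _) = EFin \o series (geometric 1 (1 - hazard p))); last first.
  apply/funext => n /=; rewrite sumEFin; congr (_%:E).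
  by apply: eq_bigr => i _; rewrite /= mul1r.
apply/cvg_EFin; first by near=> n.
have := @cvg_geometric_series R 1 (1 - hazard p); rewrite subKr mul1r; apply.
by rewrite ger0_norm ?subr_ge0 ?ltW // gtrBl.
Unshelve. all: by end_near. Qed.

Lemma first_block_size_dominated d' (T' : measurableType d')
    (Q : probability T' R) (Z : {RV Q >-> nat}) :
  has_law_geometric Z (hazard p) ->
  stochastically_dominated P (fun w => K w) Q (fun w => (Z w)%:R%:E).
Proof.
move=> lawZ x; have [x0|x0] := leP 0 x.
  rewrite tail_event_real //; apply: le_trans (tail_event_le p01 iidX _) _.
  rewrite -(geometric_tail (hazard_bounds p01)) -lawZ /distribution /pushforward.
  rewrite (_ : Z @^-1` _ = [set w | (x%:E < (Z w)%:R%:E)%E]) //.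
  by apply/eq_set => w /=; rewrite lte_fin ltr_trunc_nat.
rewrite (_ : [set w | (x%:E < (Z w)%:R%:E)%E] = setT); last first.
  by apply/seteqP; split => w //= _; rewrite lte_fin (lt_le_trans x0).
rewrite probability_setT (_ : [set w | (x%:E < K w)%E] = setT) ?probability_setT //.
apply/seteqP; split => w //= _.
case: (first_block_size_nat (R := R) (fun n => X n w)) => [->|[k ->]].
  by rewrite ltry.
by rewrite lte_fin (lt_le_trans x0).
Qed.

(** A weak form of the geometric tail, uniform in [p]: it is enough that
    [(1 - q) ^+ m <= expR (- (q * m))] and [1 + q * m >= q * x] for [q <= 1]. *)
Lemma first_block_size_tail (x : R) : 0 < x ->
  (P [set w | (x%:E < K w)%E] <= ((hazard p * x)^-1)%:E)%E.
Proof.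
move=> x0; have /andP[q0 q1] := hazard_bounds p01.
rewrite tail_event_real ?(ltW x0) //; apply: le_trans (tail_event_le p01 iidX _) _.
move: (hazard p) q0 q1 => q q0 q1; set m := Num.trunc x; rewrite lee_fin.
apply: (@le_trans _ _ (expR (- (q * m%:R)))).
  rewrite -mulNr expRM_natr lerXn2r ?nnegrE ?expR_ge0 ?subr_ge0 ?(ltW q1) //.
  exact: expR_ge1Dx.
rewrite expRN lef_pV2 ?posrE ?expR_gt0 ?mulr_gt0 //.
apply: le_trans (expR_ge1Dx _).
have xm : x <= m%:R + 1 by rewrite natr1 ltW // truncnS_gt.
by rewrite (le_trans (ler_wpM2l (ltW q0) xm)) // mulrDr mulr1 addrC lerD2r ltW.
Qed.
End conclusions.

Theorem theorem1 (R : realType) :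
  (forall (p : R) (d : measure_display) (T : measurableType d)
      (P : probability T R) (X : nat -> {RV P >-> nat}),
    0 < p < 1 -> iid_geometric X p ->
    (forall (d' : measure_display) (T' : measurableType d')
        (Q : probability T' R) (Z : {RV Q >-> nat}),
      has_law_geometric Z (p * expR (- b_const R / p)) ->
      stochastically_dominated
        P (fun w => first_block_size R (fun n => X n w))
        Q (fun w => (Z w)%:R%:E)) /\
    (\int[P]_w first_block_size R (fun n => X n w)
       <= (p^-1 * expR (b_const R / p))%:E)%E) /\
  (forall (d : R -> measure_display) (T : forall p, measurableType (d p))
      (P : forall p, probability (T p) R)
      (X : forall p, nat -> {RV (P p) >-> nat}),
    (forall p : R, 0 < p < 1 -> iid_geometric (X p) p) ->
    forall eps : R, 0 < eps ->
      P p [set w | ((expR ((b_const R + eps) / p))%:E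
                      < first_block_size R (fun n => X p n w))%E]
        @[p --> 0^'+] --> 0%E).
Proof.
have hazardV (p : R) : (hazard p)^-1 = p^-1 * expR (b_const R / p).
  by rewrite /hazard invfM /success -expRN mulNr opprK.
split=> [p d T P X p01 iidX|d T P X iidX eps eps0].
  split=> [d' T' Q Z lawZ|]; first exact: (first_block_size_dominated p01 iidX lawZ).
  by rewrite -hazardV; exact: (expectation_first_block_size p01 iidX).
(* The tail is at most [p^-1 * expR (- eps / p)], and
   [expR u >= u ^+ 2 / 2] at [u = eps / p] bounds this by [2 * p / eps ^+ 2]. *)
apply: (@squeeze_cvge _ _ _ _ (cst 0%E) _ (fun p => (2 / eps ^+ 2 * p)%:E)).
- near=> p.
  have p0 : 0 < p by near: p; exact: nbhs_right_gt.
  have p1 : p < 1 by near: p; exact: nbhs_right_lt.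
  have p01 : 0 < p < 1 by rewrite p0.
  rewrite measure_ge0 /=.
  apply: le_trans (first_block_size_tail p01 (iidX p p01) (expR_gt0 _)) _.
  rewrite lee_fin invfM hazardV -expRN -[leLHS]mulrA -expRD -mulrBl.
  rewrite opprD addrA subrr add0r mulNr expRN.
  rewrite mulrC ler_pdivrMr //.
  have exp_ge := expR_ge1Dxn 1 (divr_ge0 (ltW eps0) (ltW p0)).
  rewrite -[leRHS]invrK lef_pV2 ?posrE ?expR_gt0 ?invr_gt0 ?mulr_gt0
    ?divr_gt0 ?exprn_gt0 //; last first.
    by rewrite invr_gt0 exprn_gt0.
  apply: le_trans exp_ge; apply: ler_wpDl => //.
  rewrite le_eqVlt; apply/orP; left; apply/eqP; rewrite (_ : 2`! = 2)%N //; field.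
  by rewrite !gt_eqF.
- exact: cvg_cst.
apply/cvg_EFin; first by near=> p.
rewrite -[X in _ --> X](mulr0 (2 / eps ^+ 2)).
apply: cvg_at_right_filter; apply: cvgMr; exact: cvg_id.
Unshelve. all: by end_near. Qed.
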